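(* If $f\in C^{6}[0,1]$ and $x\in[0,1]$, then $$\tilde{U}_n^{2}(f;x)-f(x)=O\left(n^{-2}\right)\qquad (n\to\infty),$$ where $\tilde U_n^2$ is the modified genuine Bernstein-Durrmeyer operator defined in the context.
   Context: For integers $m\ge 0$ and $0\le k\le m$, let $p_{m,k}(x)=\binom{m}{k}x^k(1-x)^{m-k}$, $x\in[0,1]$, and let $p_{m,k}=0$ if $k<0$ or $k>m$. For $n\ge 2$ and $f\in C[0,1]$ define $$\tilde{U}_n^{2}(f;x)=(n-1)\sum_{k=1}^{n-1}\tilde{p}_{n,k}^{2}(x)\int_0^1 p_{n-2,k-1}(t)f(t)\,dt+\left[nx^2-(n+1)x+1\right](1-x)^{n-2}f(0)+\left[nx^2-(n-1)x\right]x^{n-2}f(1),$$ where (the superscript $2$ is an index, not a power) $$\tilde{p}_{n,k}^{2}(x)=\left[nx^2-(n+1)x+1\right]p_{n-2,k}(x)+2nx(1-x)\,p_{n-2,k-1}(x)+\left[nx^2-(n-1)x\right]p_{n-2,k-2}(x).$$ *)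

(* Defs.v *)
From mathcomp Require Import all_boot all_order all_algebra.
From mathcomp Require Import all_classical all_reals all_analysis.
Set Implicit Arguments.
Unset Strict Implicit.
Unset Printing Implicit Defensive.
Import Order.TTheory GRing.Theory Num.Theory.
Import numFieldNormedType.Exports.
Local Open Scope classical_set_scope.
Local Open Scope ring_scope.

(* Functions on [0, 1] are represented by total functions R -> R; everything
   below depends on their values on [0, 1] only. *)

(* [l] is the derivative at [x] of the restriction of [f] to [A]: the difference
   quotient is taken along points of [A], hence it is one-sided at the endpoints
   when [A] is a closed interval. *)
Definition is_derive_within (R : realType) (A : set R) (f : R -> R) (x l : R) :=
  (f y - f x) / (y - x) @[y --> within A x^'] --> l.

Fixpoint Ck_on (R : realType) (A : set R) (k : nat) (f : R -> R) : Prop :=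
  match k with
  | 0 => {within A, continuous f}
  | k'.+1 => exists g : R -> R,
      (forall x, A x -> is_derive_within A f x (g x)) /\ Ck_on A k' g
  end.

(* The index [k] is an integer, so that k - 1 and k - 2 are not truncated; for
   k > m the binomial coefficient vanishes. *)
Definition bernstein (R : realType) (m : nat) (k : int) (x : R) : R :=
  match k with
  | Posz j => 'C(m, j)%:R * x ^+ j * (1 - x) ^+ (m - j)
  | Negz _ => 0
  end.

(* This and [modU2] are meaningful for n >= 2 only, because of the truncated
   n - 2. *)
Definition modp2 (R : realType) (n : nat) (k : int) (x : R) : R :=
  (n%:R * x ^+ 2 - (n%:R + 1) * x + 1) * bernstein (n - 2) k x
  + 2 * n%:R * x * (1 - x) * bernstein (n - 2) (k - 1) x
  + (n%:R * x ^+ 2 - (n%:R - 1) * x) * bernstein (n - 2) (k - 2) x.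

Definition modU2 (R : realType) (n : nat) (f : R -> R) (x : R) : R :=
  (n%:R - 1) * (\sum_(1 <= k < n) modp2 n k%:Z x *
     \int[lebesgue_measure]_(t in `[0, 1]) (bernstein (n - 2) (k%:Z - 1) t * f t))
  + (n%:R * x ^+ 2 - (n%:R + 1) * x + 1) * (1 - x) ^+ (n - 2) * f 0
  + (n%:R * x ^+ 2 - (n%:R - 1) * x) * x ^+ (n - 2) * f 1.

(* Main.v *)
Require Import Defs.
From mathcomp Require Import all_boot all_order all_algebra.
From mathcomp Require Import all_classical all_reals all_analysis.
From mathcomp Require Import ring lra zify.
Import Order.TTheory GRing.Theory Num.Theory.
Import numFieldNormedType.Exports.
Local Open Scope classical_set_scope.
Local Open Scope ring_scope.

Set Implicit Arguments.
Unset Strict Implicit.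
Unset Printing Implicit Defensive.

(** Write phi = x (1 - x), and let F_(n,k) be the functionals that occur in the
    operator: F_(n,0) f = f 0, F_(n,n) f = f 1, and F_(n,k) f is the mean of f
    for the Beta(k, n - k) law otherwise ([nodal]). The operator is the sum of
    the ptilde_(n,k)(x) F_(n,k) f over 0 <= k <= n ([modU2_nodal]), and the
    weights are ptilde_(n,k) = p_(n,k) - (phi / n) p_(n,k)''. Thus the operator
    is U_n - (phi / n) U_n'', where U_n is the genuine Bernstein-Durrmeyer
    operator, for which U_n f - f ~ (phi / n) f'': the correction cancels the
    term of order 1/n.

    This is made precise on monomials. F_(n,k) (t^j) is the binomial coefficient
    C(k+j-1, j) divided by C(n+j-1, j), which Vandermonde's identity expands in
    the C(k, i); and the sums of C(k, i) against the weights are read off the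
    generating polynomial of the weights, with variable 1 + X
    ([blend_generating]). The j-th moment becomes a combination of the ratios
    C(n, i) / C(n+j-1, j), in which only i = j and i = j - 1 contribute up to
    O(n^-2). The two contributions of order 1/n cancel, so the operator maps t^j
    to x^j + O(n^-2) ([expands_modU2_monomial]).

    For f in C^6, Taylor's formula gives a polynomial p with
    |f t - p t| <= M |t - x|^6 on [0, 1] ([Ck_on_taylor]). The polynomial part is
    covered by the moments. For the remainder, if 0 < x < 1 then
    |ptilde_(n,k)(x)| <= (n / phi) p_(n,k)(x) ([normr_modp2_le]), and the sixth
    central moment of U_n is O(n^-3) ([sixth_central_moment_le]); the product is
    O(n^-2). The factor n lost in this crude bound on the weights is what makes
    six derivatives, rather than four, the natural hypothesis here. At x = 0 and
    x = 1 the operator interpolates f. *)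

(** * Taylor's formula on a closed interval *)

Lemma is_derive_within_continuous (R : realType) (A : set R) (f g : R -> R) :
  (forall x, A x -> is_derive_within A f x (g x)) -> {within A, continuous f}.
Proof.
move=> fg; apply/subspace_continuousP => x Ax.
have /cvgrPdist_lt /(_ 1 ltr01) fgx := fg x Ax.
apply/cvgrPdist_le => e e0.
have K0 : 0 < `|g x| + 1 by apply: ltr_wpDl.
have xe : \forall t \near x, `|x - t| < e / (`|g x| + 1).
  by apply: nbhsx_ballx; exact: divr_gt0.
move: fgx; rewrite /= !near_withinE => fgx.
near=> t => At.
have [->|tx] := eqVneq t x; first by rewrite subrr normr0 ltW.
have tx0 : t - x != 0 by rewrite subr_eq0.
have q1 : `|g x - (f t - f x) / (t - x)| < 1.
  by move: At tx; near: t; apply: filterS fgx => t gt At tx; exact: gt.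
have -> : f x - f t = (f t - f x) / (t - x) * (x - t) by field.
rewrite normrM.
apply: (@le_trans _ _ ((`|g x| + 1) * (e / (`|g x| + 1)))).
  apply: ler_pM => //; last by apply: ltW; near: t.
  rewrite -lerBlDl; apply: le_trans (ltW q1).
  by rewrite distrC; apply: lerB_dist.
by rewrite mulrC divfK// gt_eqF.
Unshelve. all: by end_near. Qed.

Lemma is_derive_within_interior (R : realType) (A : set R) (f : R -> R) x l :
  nbhs x A -> is_derive_within A f x l -> is_derive x 1 f l.
Proof.
move=> Ax fl; apply/is_derive1_caratheodory.
exists (fun z => if z == x then l else (f z - f x) / (z - x)); split.
- move=> z; case: eqP => [->|/eqP zx]; first by rewrite !subrr mulr0.
  by rewrite divfK// subr_eq0.
- rewrite /prop_for/continuous_at eqxx.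
  apply/cvgrPdist_lt => e e0.
  move/cvgrPdist_lt: fl => /(_ e e0).
  rewrite 2!near_withinE => fl; near=> z.
  case: eqP => [_|/eqP zx]; first by rewrite subrr normr0.
  by move: zx; near: z; apply: filterS2 Ax fl => z Az flz zx; exact: flz.
- by rewrite eqxx.
Unshelve. all: by end_near. Qed.

Definition poly_primitive (R : fieldType) (p : {poly R}) : {poly R} :=
  \poly_(i < (size p).+1) (p`_i.-1 / i%:R).

Lemma deriv_poly_primitive (R : realFieldType) (p : {poly R}) :
  (poly_primitive p)^`() = p.
Proof.
apply/polyP => i; rewrite coef_deriv coef_poly ltnS /=.
case: ltnP => [_|/leq_sizeP-> //]; last by rewrite mul0rn.
by rewrite -[LHS]mulr_natr divfK// pnatr_eq0.
Qed.

(** Induction on the order: a polynomial approximating f' is integrated, the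
    constant being chosen so that f - p vanishes at x, and the mean value theorem
    transfers the bound on (f - p)' to f - p at the cost of one factor
    |t - x|. Only the existence of p matters below, so its coefficients stay
    implicit. *)
Lemma Ck_on_taylor (R : realType) (a b x : R) k f :
  x \in `[a, b] -> Ck_on `[a, b] k f ->
  exists (p : {poly R}) (M : R),
    forall t, t \in `[a, b] -> `|f t - p.[t]| <= M * `|t - x| ^+ k.
Proof.
move=> xab; elim: k f => [|k IH] f /=.
  move=> fC.
  have := compact_bounded (continuous_compact fC (@segment_compact _ a b)).
  move=> [M [_ /(_ (M + 1))]]; rewrite ltrDl ltr01 => /(_ isT) fM.
  exists 0, (M + 1) => t tab; rewrite horner0 subr0 expr0 mulr1.
  by apply: fM => /=; exists t.
move=> [g [fg gC]]; have [q [M gq]] := IH g gC.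
pose p := poly_primitive q + (f x - (poly_primitive q).[x])%:P.
have p' : p^`() = q by rewrite derivD deriv_poly_primitive derivC addr0.
exists p, `|M| => t tab.
pose h : R -> R := f - horner p.
have hx : h x = 0.
  by rewrite /h !fctE hornerD hornerC [X in _ - X]addrC subrK subrr.
have hC : {within `[a, b], continuous h}.
  have fC := is_derive_within_continuous fg.
  have pC : {within `[a, b], continuous (horner p)}.
    by apply: continuous_subspaceT; exact: continuous_horner.
  by move=> u; apply: (@cvgB _ R^o); [exact: fC|exact: pC].
have hd u : u \in `]a, b[ -> is_derive u 1 h (g u - q.[u]).
  move=> uab; rewrite -p'; apply: is_deriveB.
  apply: (@is_derive_within_interior _ `[a, b]).
    by apply: filterS (near_in_itvoo uab); exact: subset_itv_oo_cc.
  by apply: fg; apply: subset_itv_oo_cc.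
have main c d : c \in `[a, b] -> d \in `[a, b] -> c <= d ->
   exists2 u, u \in `[c, d] & h d - h c = (g u - q.[u]) * (d - c).
  rewrite !in_itv/= => /andP[ac cb] /andP[ad db] cd.
  have sub : `[c, d]%classic `<=` `[a, b].
    move=> u; rewrite /= !in_itv/= => /andP[cu ud].
    by rewrite (le_trans ac cu) (le_trans ud db).
  have hd' u : u \in `]c, d[%R -> is_derive u 1 h (g u - q.[u]).
    rewrite in_itv/= => /andP[cu ud]; apply: hd; rewrite in_itv/=.
    by rewrite (le_lt_trans ac cu) (lt_le_trans ud db).
  have hC' : {within `[c, d], continuous h} by exact: continuous_subspaceW hC.
  exact: (MVT_segment cd hd' hC').
have [u [uab utx htE]] : exists u,
    [/\ u \in `[a, b], `|u - x| <= `|t - x|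
      & h t - h x = (g u - q.[u]) * (t - x)].
  case: (leP x t) => [xt|/ltW tx].
    have [u utx htE] := main x t xab tab xt; exists u.
    move: xab tab utx; rewrite !in_itv/= => /andP[ax xb] /andP[at_ tb] /andP[xu ut].
    by split=> //; [lra|rewrite !ger0_norm; lra].
  have [u utx htE] := main t x tab xab tx; exists u.
  move: xab tab utx; rewrite !in_itv/= => /andP[ax xb] /andP[at_ tb] /andP[xu ut].
  by split=> //; [lra|rewrite !ler0_norm; lra|lra].
have -> : f t - p.[t] = (g u - q.[u]) * (t - x) by rewrite -htE hx subr0.
rewrite normrM exprSr mulrA ler_wpM2r//; apply: le_trans (gq u uab) _.
apply: (@le_trans _ _ (`|M| * `|u - x| ^+ k)).
  by rewrite ler_wpM2r ?exprn_ge0 ?ler_norm.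
by rewrite ler_wpM2l// lerXn2r ?nnegrE.
Qed.

(** * Generating polynomials of the weights *)

Lemma coef_1DXn (R : comNzRingType) (c : R) n i :
  ((1 + c *: 'X) ^+ n)`_i = 'C(n, i)%:R * c ^+ i.
Proof.
rewrite exprDn coef_sum.
under eq_bigr => j _ do rewrite expr1n mul1r exprZn coefMn coefZ coefXn.
have [ni|ni] := ltnP n i.
  rewrite bin_small// mul0r big1// => j _.
  by rewrite gtn_eqF ?mulr0 ?mul0rn// (leq_trans _ ni).
rewrite (bigD1 (Ordinal (ni : (i < n.+1)%N)))//= big1 ?addr0 => [|j].
  by rewrite eqxx mulr1 mulr_natl.
by rewrite -val_eqE/= eq_sym => /negbTE->; rewrite mulr0 mul0rn.
Qed.

(** The weights ptilde_(n,k) and the Bernstein polynomials p_(n,k) both have this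
    shape, with m = n - 2 and different coefficients a, b, c. *)
Definition blend (R : realType) m (a b c : R) (k : nat) x : R :=
  a * bernstein m k x + b * bernstein m (k%:Z - 1) x
  + c * bernstein m (k%:Z - 2) x.

Lemma modp2E (R : realType) m (k : nat) (x : R) :
  modp2 m.+2 k x = blend m (m.+2%:R * x ^+ 2 - (m.+2%:R + 1) * x + 1)
    (2 * m.+2%:R * x * (1 - x)) (m.+2%:R * x ^+ 2 - (m.+2%:R - 1) * x) k x.
Proof. by rewrite /modp2 /blend !subSS subn0. Qed.

(** The binomial theorem for the shifted index: for s <= 2 the range k < m + 3
    contains the whole support of k |-> p_(m,k-s). *)
Lemma sum_bernstein_shift (R : realType) m s (x : R) (p : {poly R}) :
  (s <= 2)%N ->
  \sum_(k < m.+3) bernstein m (k%:Z - s%:Z) x *: p ^+ k =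
  p ^+ s * ((1 - x)%:P + x *: p) ^+ m.
Proof.
move=> s2; have -> : (m.+3 = s + (m.+1 + (2 - s)))%N by lia.
rewrite big_split_ord /= big1 ?add0r => [|i _]; last first.
  have -> : i%:Z - s%:Z = Negz (s - i).-1 by have := ltn_ord i; lia.
  by rewrite /= scale0r.
rewrite big_split_ord /= [X in _ + X]big1 ?addr0 => [|i _]; last first.
  have -> : (s + (m.+1 + i))%:Z - s%:Z = (m.+1 + i)%:Z by lia.
  by rewrite /= bin_small ?mul0r ?scale0r// leq_addr.
rewrite exprDn mulr_sumr; apply: eq_bigr => i _.
have -> : (s + i)%:Z - s%:Z = i by lia.
rewrite /= exprD exprZn -polyC_exp mul_polyC !scalerA !scalerAr.
by rewrite -[in RHS]scaler_nat scalerA; congr (_ * (_ *: _)); ring.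
Qed.

Lemma blend_generating (R : realType) m (a b c x : R) (p : {poly R}) :
  \sum_(k < m.+3) blend m a b c k x *: p ^+ k =
  (a%:P + b *: p + c *: p ^+ 2) * ((1 - x)%:P + x *: p) ^+ m.
Proof.
under eq_bigr => k _ do
  rewrite /blend !scalerDl -(scalerA a) -(scalerA b) -(scalerA c).
rewrite !big_split/= -!scaler_sumr.
have -> : \sum_(k < m.+3) bernstein m k x *: p ^+ k
    = ((1 - x)%:P + x *: p) ^+ m.
  rewrite -[RHS]mul1r -(expr0 p) -sum_bernstein_shift//.
  by apply: eq_bigr => k _; rewrite subr0.
rewrite (@sum_bernstein_shift R m 1)// (@sum_bernstein_shift R m 2)//.
by rewrite -!mul_polyC; ring.
Qed.

(** The previous identity at p = 1 + X, whose k-th power has C(k, i) as its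
    coefficient of X^i. *)
Lemma sum_blend_bin (R : realType) m (a b c x : R) i :
  \sum_(k < m.+3) blend m a b c k x * 'C(k, i)%:R =
  ((a%:P + b *: (1 + 'X) + c *: (1 + 'X) ^+ 2) * (1 + x *: 'X) ^+ m)`_i.
Proof.
have -> : 1 + x *: 'X = (1 - x)%:P + x *: (1 + 'X) :> {poly R}.
  by rewrite -!mul_polyC polyCB polyC1; ring.
rewrite -blend_generating coef_sum; apply: eq_bigr => k _.
by rewrite coefZ -['X]scale1r coef_1DXn expr1n mulr1.
Qed.

(** This is p_(m+2,k)(x), written by means of the degree raising formula, in the
    shape that compares termwise with [modp2E]. *)
Definition classical_weight (R : realType) m (k : nat) (x : R) :=
  blend m ((1 - x) ^+ 2) (2 * (x * (1 - x))) (x ^+ 2) k x.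

(** Here a + b (1 + X) + c (1 + X)^2 = (1 + x X)^2. *)
Lemma sum_classical_weight_bin (R : realType) m (x : R) i :
  \sum_(k < m.+3) classical_weight m k x * 'C(k, i)%:R =
  'C(m.+2, i)%:R * x ^+ i.
Proof.
rewrite sum_blend_bin -coef_1DXn -[m.+2]addn2 exprD [_ ^+ m * _]mulrC.
suff -> : ((1 - x) ^+ 2)%:P + 2 * (x * (1 - x)) *: (1 + 'X)
   + x ^+ 2 *: (1 + 'X) ^+ 2 = (1 + x *: 'X) ^+ 2 :> {poly R} by [].
rewrite -!mul_polyC !(polyCM, polyC_exp, polyCB, polyC1).
rewrite -[2]/(1 *+ 2) polyCMn polyC1.
by ring.
Qed.

(** With n = m + 2, the coefficients of ptilde_(n,k) satisfy
    a + b (1 + X) + c (1 + X)^2 = (1 + x X)^2 - (n - 1) x (1 - x) X^2. The last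
    term carries the correction by the second derivative; it appears below as
    x (1 - x) / n times the second derivative i (i - 1) x^(i-2) of x^i. *)
Lemma sum_modp2_bin (R : realType) m (x : R) i :
  \sum_(k < m.+3) modp2 m.+2 k x * 'C(k, i)%:R =
  'C(m.+2, i)%:R *
    (x ^+ i - (i * i.-1)%:R * (x * (1 - x)) * x ^+ (i - 2) / m.+2%:R).
Proof.
under eq_bigr => k _ do rewrite modp2E.
rewrite sum_blend_bin.
transitivity (((1 + x *: 'X) ^+ m.+2
   - (m.+1%:R * (x * (1 - x))) *: 'X^2 * (1 + x *: 'X) ^+ m)`_i).
  rewrite -addn2 exprD [_ ^+ m * _ ^+ 2]mulrC -mulrBl.
  congr ((_ * _ : {poly R}) `_i).
  rewrite -!mul_polyC.
  rewrite !(polyCM, polyC_exp, polyCB, polyC1, polyCD, polyC_natr).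
  by rewrite -[m.+1]addn1 !natrD; ring.
rewrite coefB -scalerAl coefZ coefXnM !coef_1DXn.
have m0 : m.+2%:R != 0 :> R by rewrite pnatr_eq0.
case: i => [|[|i]]; rewrite ?mul0n ?muln0 ?mul0r ?mulr0 ?subr0//=.
have H : (i.+2 * i.+1)%:R * 'C(m.+2, i.+2)%:R
    = (m.+2 * m.+1)%:R * 'C(m, i)%:R :> R.
  rewrite -!natrM; congr (_%:R).
  have h1 := mul_bin_diag m.+2 i.+1; have h2 := mul_bin_diag m.+1 i.
  by rewrite [(i.+2 * _)%N]mulnC -mulnA -h1 mulnCA -h2 mulnA.
rewrite !subSS !subn0 [RHS]mulrBr; congr (_ - _).
transitivity (((m.+2 * m.+1)%:R * 'C(m, i)%:R)
  * (x * (1 - x) * x ^+ i) / m.+2%:R :> R).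
  by rewrite natrM; field.
by rewrite -H; ring.
Qed.

(** * The nodal functionals *)

Section WithinContinuous.
Variables (R : realType) (A : set R).
Implicit Types f g : R -> R.

Lemma within_continuous_cst c : {within A, continuous (fun=> c : R)}.
Proof. by move=> u; exact: cvg_cst. Qed.

Lemma within_continuousM f g : {within A, continuous f} ->
  {within A, continuous g} -> {within A, continuous (fun t => f t * g t)}.
Proof. by move=> fC gC u; exact: cvgM (fC u) (gC u). Qed.

Lemma within_continuousD f g : {within A, continuous f} ->
  {within A, continuous g} -> {within A, continuous (fun t => f t + g t)}.
Proof. by move=> fC gC u; exact: (@cvgD _ R^o _ _ _ _ _ _ _ (fC u) (gC u)). Qed.

Lemma within_continuousZ c f :
  {within A, continuous f} -> {within A, continuous (fun t => c * f t)}.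
Proof. exact/within_continuousM/within_continuous_cst. Qed.

Lemma within_continuous_sum d (c : nat -> R) (F : nat -> R -> R) :
  (forall j, {within A, continuous (F j)}) ->
  {within A, continuous (fun t => \sum_(j < d) c j * F j t)}.
Proof.
move=> FC; elim: d => [|d IH].
  by under eq_fun do rewrite big_ord0; exact: within_continuous_cst.
under eq_fun do rewrite big_ord_recr/=.
by apply: within_continuousD => //; exact: within_continuousZ.
Qed.

End WithinContinuous.

(** The values f 0 and f 1 are the limits of the Beta means as k tends to 0 and
    n; including them makes the operator a single sum over 0 <= k <= n. *)
Definition nodal (R : realType) (n k : nat) (f : R -> R) : R :=
  if k == 0%N then f 0 else if k == n then f 1 else
  (n%:R - 1) * \int[lebesgue_measure]_(t in `[0, 1])
     (bernstein (n - 2) (k%:Z - 1) t * f t).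

Lemma modU2_nodal (R : realType) m (f : R -> R) x :
  modU2 m.+2 f x = \sum_(k < m.+3) modp2 m.+2 k x * nodal m.+2 k f.
Proof.
rewrite big_ord_recl big_ord_recr /= /modU2 mulr_sumr big_add1 big_mkord.
rewrite /nodal eqxx [X in _ = _ + (_ + X)]/= /bump /= !add1n eqxx -addrA addrCA.
congr (_ + (_ + _)).
- rewrite /modp2 !subSS !subn0 /=.
  by rewrite !mulr0 !addr0 bin0 expr0 !mul1r subn0.
- apply: eq_bigr => k _; rewrite add1n eqSS ltn_eqF ?ltn_ord//=.
  by rewrite mulrCA.
- rewrite /modp2 !subSS !subn0.
  have -> : m.+2%:Z - 1 = m.+1 by lia.
  have -> : m.+2%:Z - 2 = m by lia.
  rewrite /= (bin_small (ltnSn m)) (@bin_small m m.+2) ?leqnSn//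
    binn subnn expr0.
  by rewrite !mul0r !mulr0 !add0r mul1r mulr1.
Qed.

Section Nodal.
Variable R : realType.
Implicit Types f g : R -> R.

Lemma bernstein_ge0 m k (x : R) : x \in `[0, 1] -> 0 <= bernstein m k x.
Proof.
rewrite in_itv/= => /andP[x0 x1]; case: k => k //=.
by rewrite !mulr_ge0// ?exprn_ge0// subr_ge0.
Qed.

Lemma continuous_bernstein m k : continuous (@bernstein R m k).
Proof.
case: k => k x; last exact: cvg_cst.
apply: (@cvgM _ R^o).
  by apply: (@cvgM _ R^o); [exact: cvg_cst|exact: exprn_continuous].
exact: continuous_onemXn.
Qed.

Lemma integrable_bernsteinM m k f : {within `[0, 1], continuous f} ->
  lebesgue_measure.-integrable `[0, 1]
    (EFin \o (fun t => bernstein m k t * f t)).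
Proof.
move=> fC; apply: continuous_compact_integrable; first exact: segment_compact.
have bC : {within `[0, 1], continuous (@bernstein R m k)}.
  by apply: continuous_subspaceT; exact: continuous_bernstein.
exact: within_continuousM.
Qed.

Lemma nodalD n k f g :
  {within `[0, 1], continuous f} -> {within `[0, 1], continuous g} ->
  nodal n k (fun t => f t + g t) = nodal n k f + nodal n k g.
Proof.
move=> fC gC; rewrite /nodal; case: ifP => // _; case: ifP => // _.
rewrite -mulrDr; congr (_ * _).
under eq_Rintegral do rewrite mulrDr.
by rewrite RintegralD//; exact: integrable_bernsteinM.
Qed.

Lemma nodalZ n k c f : {within `[0, 1], continuous f} ->
  nodal n k (fun t => c * f t) = c * nodal n k f.
Proof.
move=> fC; rewrite /nodal; case: ifP => // _; case: ifP => // _.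
under eq_Rintegral do rewrite mulrCA.
by rewrite RintegralZl//; [rewrite mulrCA|exact: integrable_bernsteinM].
Qed.

Lemma nodal_sum n k d (c : nat -> R) (F : nat -> R -> R) :
  (forall j, {within `[0, 1], continuous (F j)}) ->
  nodal n k (fun t => \sum_(j < d) c j * F j t) =
  \sum_(j < d) c j * nodal n k (F j).
Proof.
move=> FC.
elim: d => [|d IH].
  rewrite big_ord0; under eq_fun do rewrite big_ord0 -[0](mul0r 0).
  by rewrite nodalZ ?mul0r//; exact: within_continuous_cst.
under eq_fun do rewrite big_ord_recr/=.
rewrite big_ord_recr/= nodalD ?nodalZ ?IH//; first exact: within_continuous_sum.
exact: within_continuousZ.
Qed.

Lemma le_nodal n k f g : (0 < n)%N ->
  {within `[0, 1], continuous f} -> {within `[0, 1], continuous g} ->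
  (forall t, t \in `[0, 1] -> f t <= g t) -> nodal n k f <= nodal n k g.
Proof.
move=> n0 fC gC fg; rewrite /nodal; case: ifP => _.
  by apply: fg; rewrite in_itv/= lexx ler01.
case: ifP => _; first by apply: fg; rewrite in_itv/= lexx ler01.
apply: ler_wpM2l; first by rewrite subr_ge0 ler1n.
apply: le_Rintegral => //; try exact: integrable_bernsteinM.
by move=> t t01; apply: ler_wpM2l; [exact: bernstein_ge0|exact: fg].
Qed.

Lemma ler_norm_nodal n k f g : (0 < n)%N ->
  {within `[0, 1], continuous f} -> {within `[0, 1], continuous g} ->
  (forall t, t \in `[0, 1] -> `|f t| <= g t) -> `|nodal n k f| <= nodal n k g.
Proof.
move=> n0 fC gC fg; rewrite ler_norml; apply/andP; split; last first.
  by apply: le_nodal => // t /fg; apply: le_trans; exact: ler_norm.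
rewrite -mulN1r -nodalZ//; apply: le_nodal => //.
  exact: within_continuousZ.
by move=> t /fg; rewrite ler_norml mulN1r => /andP[].
Qed.

Lemma natr_bin_fact n k : (k <= n)%N ->
  'C(n, k)%:R = n`!%:R / (k`!%:R * (n - k)`!%:R) :> R.
Proof.
move=> kn; rewrite -(bin_fact kn) !natrM mulfK// mulf_neq0//;
  by rewrite pnatr_eq0 -lt0n fact_gt0.
Qed.

(** A Beta integral for 0 < k < n. The formula also holds at both ends: at k = 0,
    C(j - 1, j) vanishes unless j = 0, where the truncated 0 - 1 is harmless since
    C(_, 0) = 1. *)
Lemma nodal_monomial m k j : (k <= m.+2)%N ->
  nodal m.+2 k (fun t : R => t ^+ j) =
  'C((k + j).-1, j)%:R / 'C((m.+2 + j).-1, j)%:R.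
Proof.
have f0 i : i`!%:R != 0 :> R by rewrite pnatr_eq0 -lt0n fact_gt0.
move=> km; rewrite /nodal; case: eqP => [->|/eqP k0].
  rewrite expr0n add0n; case: j => [|j] /=; first by rewrite !bin0 divr1.
  by rewrite bin_small// mul0r.
case: eqP => [->|/eqP km2].
  rewrite expr1n divff// pnatr_eq0 -lt0n bin_gt0; lia.
have [l kE] : exists l, k = l.+1 by exists k.-1; lia.
rewrite {}kE in k0 km km2 *.
have lm : (l <= m)%N by lia.
rewrite !subSS subn0 (_ : l.+1%:Z - 1 = l); last by lia.
have -> : \int[lebesgue_measure]_(t in `[0, 1]) (bernstein m l t * t ^+ j)
        = 'C(m, l)%:R * beta_fun (l + j).+1 (m - l).+1 :> R.
  rewrite /beta_fun -Rintegral_mkcond -RintegralZl//; last first.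
    exact: integrable_XMonemX.
  by apply: eq_Rintegral => t _; rewrite /bernstein /XMonemX exprD/=; ring.
rewrite beta_fun_fact natrM.
rewrite !natr_bin_fact; [|lia..].
have -> : ((l + j + (m - l)).+1 = (m + j).+1)%N by lia.
have -> : ((l.+1 + j).-1 - j = l)%N by lia.
have -> : ((m.+2 + j).-1 - j = m.+1)%N by lia.
have -> : ((l.+1 + j).-1 = l + j)%N by lia.
have -> : ((m.+2 + j).-1 = (m + j).+1)%N by lia.
rewrite [m.+1`!]factS natrM -[m.+2]addn1 natrD addrK.
by field; rewrite !f0 nat1r pnatr_eq0.
Qed.

(** Vandermonde's identity turns the rising factorial of k into the C(k, i), whose
    sums against the weights are known. *)
Lemma nodal_monomial_bin m k j : (k <= m.+2)%N ->
  nodal m.+2 k (fun t : R => t ^+ j) =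
  \sum_(i < j.+1) 'C(k, i)%:R * ('C(j.-1, j - i)%:R / 'C((m.+2 + j).-1, j)%:R).
Proof.
move=> km; rewrite nodal_monomial//.
have -> : 'C((k + j).-1, j) = 'C(k + j.-1, j).
  by case: j => [|j]; [rewrite !bin0|rewrite addnS].
rewrite -binomial.Vandermonde natr_sum mulr_suml.
by apply: eq_bigr => i _; rewrite natrM mulrA.
Qed.

End Nodal.

(** * Expansions to first order in 1/n *)

(** u n = a + b / n + O(n^-2). The index is shifted, n = m + 2, so that the bound
    holds for every m and n is invertible. *)
Definition expands (R : realType) (u : nat -> R) (a b : R) := exists C : R,
  forall m, `|u m - (a + b / m.+2%:R)| <= C / m.+2%:R ^+ 2.

Section Expansions.
Variable R : realType.
Implicit Types (u v : nat -> R).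

Lemma eq_expands u v a b a' b' :
  u =1 v -> a = a' -> b = b' -> expands u a b -> expands v a' b'.
Proof. by move=> uv <- <- [C H]; exists C => m; rewrite -uv. Qed.

Lemma expands_cst (c : R) : expands (fun=> c) c 0.
Proof. by exists 0 => m; rewrite mul0r addr0 subrr normr0 mul0r. Qed.

Lemma expandsD u v a b a' b' : expands u a b -> expands v a' b' ->
  expands (fun m => u m + v m) (a + a') (b + b').
Proof.
move=> [C uC] [D vD]; exists (C + D) => m.
rewrite [X in `|X|](_ : _ = (u m - (a + b / m.+2%:R))
  + (v m - (a' + b' / m.+2%:R))); last by ring.
by rewrite mulrDl; apply: le_trans (ler_normD _ _) _; apply: lerD.
Qed.

Lemma expandsM u v a b a' b' : expands u a b -> expands v a' b' ->
  expands (fun m => u m * v m) (a * a') (a * b' + b * a').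
Proof.
move=> [C uC] [D vD].
exists (C * (`|a'| + `|b'| + D) + (`|a| + `|b|) * D + `|b * b'|) => m.
set N : R := m.+2%:R; have N1 : 1 <= N by rewrite ler1n.
have N0 : N != 0 by rewrite gt_eqF// (lt_le_trans ltr01).
have V1 : N^-1 <= 1 by rewrite invf_le1// (lt_le_trans ltr01).
have V0 : 0 <= N^-1 by rewrite invr_ge0 (le_trans ler01).
have norm_lin (c d : R) : `|c + d / N| <= `|c| + `|d|.
  apply: le_trans (ler_normD _ _) _; rewrite lerD2l normrM [`|N^-1|]ger0_norm//.
  exact: ler_piMr.
have V2 : (N ^+ 2)^-1 = N^-1 * N^-1 by rewrite expr2 invfM.
have D0 : 0 <= D.
  by have := le_trans (normr_ge0 _) (vD 0%N); rewrite pmulr_lge0 ?invr_gt0.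
have vB : `|v m| <= `|a'| + `|b'| + D.
  rewrite -[v m](subrK (a' + b' / N)) addrC; apply: le_trans (ler_normD _ _) _.
  apply: lerD; first exact: norm_lin.
  by apply: le_trans (vD m) _; rewrite -/N V2 ler_piMr// mulr_ile1.
rewrite [X in `|X|](_ : _ = (u m - (a + b / N)) * v m
   + (a + b / N) * (v m - (a' + b' / N)) + b * b' / N ^+ 2); last by field.
rewrite [leRHS]mulrDl; apply: le_trans (ler_normD _ _) _; apply: lerD; last first.
  by rewrite normrM [`|_^-1|]ger0_norm// invr_ge0 exprn_ge0// (le_trans ler01).
rewrite [leRHS]mulrDl; apply: le_trans (ler_normD _ _) _; rewrite !normrM.
apply: lerD.
  by rewrite mulrAC; apply: ler_pM.
by rewrite -mulrA; apply: ler_pM.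
Qed.

Lemma expands_sum d (c : nat -> nat -> R) (a b : nat -> R) :
  (forall i, (i < d)%N -> expands (c i) (a i) (b i)) ->
  expands (fun m => \sum_(i < d) c i m) (\sum_(i < d) a i) (\sum_(i < d) b i).
Proof.
elim: d => [|d IH] H.
  apply: eq_expands (expands_cst 0) => [m||]; by rewrite big_ord0.
have := expandsD (IH (fun i id => H i (ltnW id))) (H d (ltnSn d)).
by apply: eq_expands => [m||]; rewrite big_ord_recr.
Qed.

Lemma expands_invn (c : R) : expands (fun m => c / m.+2%:R) 0 c.
Proof. by exists 0 => m; rewrite add0r subrr normr0 mul0r. Qed.

Lemma expands_shiftV (l : nat) : expands (fun m => (m.+2%:R + l%:R)^-1 : R) 0 1.
Proof.
exists l%:R => m; set N : R := m.+2%:R.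
have N0 : 0 < N by rewrite ltr0n.
have NL : N <= N + l%:R by rewrite lerDl.
have NL0 : 0 < N + l%:R by exact: lt_le_trans NL.
rewrite [X in `|X|](_ : _ = - (l%:R / (N * (N + l%:R)))); last first.
  by field; rewrite !gt_eqF.
rewrite normrN ger0_norm; last by rewrite divr_ge0// mulr_ge0// ltW.
by rewrite ler_wpM2l// lef_pV2 ?posrE ?exprn_gt0 ?mulr_gt0// expr2 ler_pM2l.
Qed.

(** Because (n - k) / (n + l) = 1 - (k + l) / (n + l). *)
Lemma expands_shift_ratio (k l : nat) :
  expands (fun m => (m.+2%:R - k%:R) / (m.+2%:R + l%:R) : R) 1 (- (k + l)%:R).
Proof.
have := expandsD (expands_cst 1)
  (expandsM (expands_cst (- (k + l)%:R)) (expands_shiftV l)).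
apply: eq_expands => [m||]; rewrite ?natrD; [|ring..].
have : m.+2%:R + l%:R != 0 :> R by rewrite -natrD pnatr_eq0.
by move: (m.+2%:R : R) => N N0; field.
Qed.

Definition bin_ratio (i j m : nat) : R :=
  'C(m.+2, i)%:R / 'C((m.+2 + j).-1, j)%:R.

Lemma bin_ratioS i j m :
  bin_ratio i j.+1 m = bin_ratio i j m * (j.+1%:R / (m.+2%:R + j%:R)).
Proof.
rewrite /bin_ratio addnS /=.
have H : j.+1%:R * 'C(m.+2 + j, j.+1)%:R
    = (m.+2%:R + j%:R) * 'C((m.+2 + j).-1, j)%:R :> R.
  by rewrite -natrD -!natrM; congr _%:R; rewrite -mul_bin_diag.
have B0 : 'C((m.+2 + j).-1, j)%:R != 0 :> R.
  by rewrite pnatr_eq0 -lt0n bin_gt0; lia.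
have B1 : 'C(m.+2 + j, j.+1)%:R != 0 :> R.
  by rewrite pnatr_eq0 -lt0n bin_gt0; lia.
have N0 : m.+2%:R + j%:R != 0 :> R by rewrite -natrD pnatr_eq0.
have J0 : j.+1%:R != 0 :> R by rewrite pnatr_eq0.
have -> : 'C(m.+2 + j, j.+1)%:R
    = (m.+2%:R + j%:R) * 'C((m.+2 + j).-1, j)%:R / j.+1%:R :> R.
  by rewrite -H mulrAC divff// mul1r.
move: N0 J0; move: (m.+2%:R : R) (j.+1%:R : R) => N J N0 J0.
by field; rewrite N0 B0 J0.
Qed.

Lemma bin_ratioSl i j m :
  bin_ratio i.+1 j m = bin_ratio i j m * ((m.+2%:R - i%:R) / i.+1%:R).
Proof.
rewrite /bin_ratio.
have [im|mi] := leqP i m.+2; last first.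
  by rewrite (bin_small mi) (bin_small (leqW mi)) !mul0r.
have H : i.+1%:R * 'C(m.+2, i.+1)%:R = (m.+2%:R - i%:R) * 'C(m.+2, i)%:R :> R.
  by rewrite -natrB// -!natrM; congr _%:R; rewrite mul_bin_left.
have J0 : i.+1%:R != 0 :> R by rewrite pnatr_eq0.
by rewrite -[in LHS](mulKf J0 'C(m.+2, i.+1)%:R) H; ring.
Qed.

Lemma bin_ratio_diagS i m :
  bin_ratio i.+1 i.+1 m =
  bin_ratio i i m * ((m.+2%:R - i%:R) / (m.+2%:R + i%:R)).
Proof.
rewrite bin_ratioSl bin_ratioS.
have : m.+2%:R + i%:R != 0 :> R by rewrite -natrD pnatr_eq0.
have : i.+1%:R != 0 :> R by rewrite pnatr_eq0.
move: (m.+2%:R : R) (i.+1%:R : R) => N J J0 N0.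
by field; rewrite N0 J0.
Qed.

(** C(n, i) / C(n+i-1, i) is the product of the (n - l) / (n + l) for l < i, and the
    sum of the 2 l for l < i is i (i - 1). *)
Lemma expands_bin_ratio_diag i :
  expands (bin_ratio i i) 1 (- (i * i.-1)%:R).
Proof.
elim: i => [|i IH].
  apply: eq_expands (expands_cst 1) => [m||]; [|by []|by rewrite oppr0].
  by rewrite /bin_ratio !bin0 divr1.
apply: eq_expands (expandsM IH (expands_shift_ratio i i)) => [m||].
- by rewrite bin_ratio_diagS.
- by rewrite mul1r.
- rewrite mul1r mulr1 -opprD -natrD; congr (- _%:R).
  by case: {IH} i => [|i] //=; lia.
Qed.

Lemma expands_bin_ratio_subdiag i : expands (bin_ratio i i.+1) 0 i.+1%:R.
Proof.
have := expandsM (expands_bin_ratio_diag i)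
  (expandsM (expands_cst i.+1%:R) (expands_shiftV i)).
by apply: eq_expands => [m||]; [rewrite bin_ratioS| ring | ring].
Qed.

(** Each further step in j contributes a factor of order 1/n; two of them already
    make O(n^-2). *)
Lemma expands_bin_ratio_small i j : (i.+2 <= j)%N -> expands (bin_ratio i j) 0 0.
Proof.
elim: j => // j IH; rewrite ltnS leq_eqVlt => /predU1P[<-|ij].
  have := expandsM (expands_bin_ratio_subdiag i)
    (expandsM (expands_cst i.+2%:R) (expands_shiftV i.+1)).
  by apply: eq_expands => [m||]; [rewrite [RHS]bin_ratioS| ring | ring].
have := expandsM (IH ij)
  (expandsM (expands_cst j.+1%:R) (expands_shiftV j)).
by apply: eq_expands => [m||]; [rewrite [RHS]bin_ratioS| ring | ring].
Qed.

End Expansions.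

(** * Moments *)

Section Moments.
Variable R : realType.

(** Serves both the weights ptilde_(n,k), with s i the corrected power of x, and
    the weights p_(n,k), with s i = x^i. *)
Lemma sum_weight_monomial m j (w s : nat -> R) :
  (forall i, \sum_(k < m.+3) w k * 'C(k, i)%:R = 'C(m.+2, i)%:R * s i) ->
  \sum_(k < m.+3) w k * nodal m.+2 k (fun t => t ^+ j) =
  \sum_(i < j.+1) 'C(j.-1, j - i)%:R * (bin_ratio R i j m * s i).
Proof.
move=> ws; under eq_bigr => k _.
  rewrite nodal_monomial_bin ?mulr_sumr; last by have := ltn_ord k; lia.
  over.
rewrite exchange_big /=; apply: eq_bigr => i _.
under eq_bigr do rewrite (mulrA (w _)).
by rewrite -mulr_suml ws /bin_ratio; ring.
Qed.

Lemma modU2_monomial m j (x : R) :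
  modU2 m.+2 (fun t => t ^+ j) x =
  \sum_(i < j.+1) 'C(j.-1, j - i)%:R * (bin_ratio R i j m *
    (x ^+ i - (i * i.-1)%:R * (x * (1 - x)) * x ^+ (i - 2) / m.+2%:R)).
Proof.
rewrite modU2_nodal (@sum_weight_monomial m j (fun k => modp2 m.+2 k x)
  (fun i => x ^+ i - (i * i.-1)%:R * (x * (1 - x)) * x ^+ (i - 2) / m.+2%:R))//.
by move=> i; exact: sum_modp2_bin.
Qed.

(** The coefficient of 1/n in the term i = j is -j (j-1) (x^j + phi x^(j-2)), which
    is -j (j-1) x^(j-1) because phi x^(j-2) = x^(j-1) - x^j; the term i = j - 1
    contributes the opposite, and the terms i <= j - 2 contribute nothing. *)
Lemma expands_modU2_monomial j (x : R) :
  expands (fun m => modU2 m.+2 (fun t => t ^+ j) x) (x ^+ j) 0.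
Proof.
pose d i : R := - ((i * i.-1)%:R * (x * (1 - x)) * x ^+ (i - 2)).
have term i a b : expands (bin_ratio R i j) a b ->
    expands (fun m => 'C(j.-1, j - i)%:R * (bin_ratio R i j m *
      (x ^+ i - (i * i.-1)%:R * (x * (1 - x)) * x ^+ (i - 2) / m.+2%:R)))
      ('C(j.-1, j - i)%:R * (a * x ^+ i))
      ('C(j.-1, j - i)%:R * (a * d i + x ^+ i * b)).
  move=> H; have := expandsM (expands_cst _) (expandsM H
    (expandsD (expands_cst (x ^+ i)) (expands_invn (d i)))).
  move=> /(_ 'C(j.-1, j - i)%:R).
  by apply: eq_expands => [m||]; rewrite /d; ring.
have top := term j _ _ (expands_bin_ratio_diag R j).
suff : expands (fun m => \sum_(i < j) 'C(j.-1, j - i)%:R * (bin_ratio R i j m *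
    (x ^+ i - (i * i.-1)%:R * (x * (1 - x)) * x ^+ (i - 2) / m.+2%:R)))
    0 ((j * j.-1)%:R * x ^+ j.-1).
  move=> H; have := expandsD H top; apply: eq_expands => [m||].
  - by rewrite modU2_monomial big_ord_recr.
  - by rewrite subnn bin0; ring.
  - rewrite subnn bin0 /d.
    case: (j) => [|[|l]]; rewrite /= ?mul0n ?muln0; [ring|ring|].
    by rewrite subSS subSS subn0 !exprS; ring.
case: j {top} term => [|j] term.
  by apply: eq_expands (expands_cst 0) => [m||]; rewrite ?big_ord0 ?mul0n ?mul0r.
have low i : (i < j)%N -> expands (fun m => 'C(j, j.+1 - i)%:R *
    (bin_ratio R i j.+1 m *
    (x ^+ i - (i * i.-1)%:R * (x * (1 - x)) * x ^+ (i - 2) / m.+2%:R))) 0 0.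
  move=> ij; have ij2 : (i.+2 <= j.+1)%N by [].
  have := term i _ _ (expands_bin_ratio_small R ij2).
  by apply: eq_expands => [m||] //; ring.
have := expandsD (expands_sum low) (term j _ _ (expands_bin_ratio_subdiag R j)).
apply: eq_expands => [m||]; first by rewrite [RHS]big_ord_recr.
  by rewrite big1// mul0r mulr0 addr0.
by rewrite big1// subSn// subnn bin1 natrM /=; ring.
Qed.

(** The numerator has degree 2 in n against degree 5 in the denominator: the
    cancellation of all higher powers of n is that of the central moments of a
    law with variance of order 1/n. *)
Lemma sixth_central_moment m (x : R) (N := m.+2%:R) (y := x * (1 - x)) :
  \sum_(k < m.+3)
    classical_weight m k x * nodal m.+2 k (fun t => (t - x) ^+ 6) =
  (120 * y ^+ 3 * N ^+ 2 + (1080 * y ^+ 2 - 3960 * y ^+ 3) * N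
   + (720 * y - 4680 * y ^+ 2 + 7440 * y ^+ 3)) /
  ((N + 1) * (N + 2) * (N + 3) * (N + 4) * (N + 5)).
Proof.
pose c j : R := 'C(6, j)%:R * (- x) ^+ (6 - j).
have -> : (fun t => (t - x) ^+ 6) = (fun t => \sum_(j < 7) c j * t ^+ j).
  apply/funext => t; rewrite addrC exprDn; apply: eq_bigr => j _.
  by rewrite /c -mulrA mulr_natl.
under eq_bigr => k _.
  rewrite (@nodal_sum _ _ _ 7 c (fun j t => t ^+ j)); last first.
    by move=> j; apply: continuous_subspaceT; exact: exprn_continuous.
  rewrite mulr_sumr; over.
rewrite exchange_big /=.
under eq_bigr => j _.
  under eq_bigr do rewrite mulrCA.
  rewrite -mulr_sumr (@sum_weight_monomial m j (fun k => classical_weight m k x)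
    (fun i => x ^+ i)); last by move=> i; exact: sum_classical_weight_bin.
  over.
rewrite /c; rewrite !big_ord_recr !big_ord0 /=.
(* the recursions in both indices make each ratio an explicit fraction in n *)
have r00 : bin_ratio R 0 0 m = 1 by rewrite /bin_ratio !bin0 divr1.
rewrite !bin_ratioS !bin_ratioSl r00 /y.
rewrite !(subSS, subn0, subnn, binS, bin0, bin0n)/= ?(addn0, add0n).
have Npos (l : nat) : N + l%:R != 0 by rewrite /N -natrD pnatr_eq0.
move: (Npos 0%N) (Npos 1%N) (Npos 2%N) (Npos 3%N) (Npos 4%N) (Npos 5%N).
rewrite -/N addr0 {Npos}; move: (N) => {}N N0 N1 N2 N3 N4 N5.
field.
by rewrite N0 N1 N2 N3 N4 N5.
Qed.
End Moments.

Lemma sixth_central_moment_le (R : realType) m (x : R) : x \in `[0, 1] ->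
  \sum_(k < m.+3)
    classical_weight m k x * nodal m.+2 k (fun t => (t - x) ^+ 6)
  <= 10000 / m.+2%:R ^+ 3.
Proof.
rewrite in_itv/= => /andP[x0 x1]; rewrite sixth_central_moment.
have [y0 y1] : 0 <= x * (1 - x) /\ x * (1 - x) <= 1 by split; nra.
move: (x * (1 - x)) y0 y1 => y y0 y1.
have N1 : 1 <= m.+2%:R :> R by rewrite ler1n.
move: (m.+2%:R : R) N1 => N N1.
have N0 : 0 < N by exact: lt_le_trans N1.
rewrite ler_pdivrMr ?mulr_gt0 ?ltr_wpDr//.
(* 10000 exceeds 120 + 1080 + 720 + 7440, the positive coefficients *)
apply: (@le_trans _ _ (10000 * N ^+ 2)).
  have y2 : y ^+ 2 <= 1 by rewrite exprn_ile1.
  have y3 : y ^+ 3 <= 1 by rewrite exprn_ile1.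
  have y20 : 0 <= y ^+ 2 by rewrite exprn_ge0.
  have y30 : 0 <= y ^+ 3 by rewrite exprn_ge0.
  have N2 : N <= N ^+ 2 by rewrite expr2 ler_peMl// ltW.
  have N20 : 0 <= N ^+ 2 by rewrite exprn_ge0// ltW.
  have a1 : y ^+ 3 * N ^+ 2 <= N ^+ 2 by rewrite ler_piMl.
  have a2 : y ^+ 2 * N <= N by rewrite ler_piMl// ltW.
  have a3 : 0 <= y ^+ 3 * N by rewrite mulr_ge0// ltW.
  lra.
rewrite mulrAC ler_pdivlMr ?exprn_gt0//.
rewrite (_ : _ * N ^+ 3 = 10000 * (N * N * N * N * N)); last by ring.
apply: ler_wpM2l; first exact: ler0n.
have Nge0 : 0 <= N by exact: ltW.
by do 4?[apply: ler_pM; rewrite ?(mulr_ge0, lerDl, ler0n, ler01)].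
Qed.

(** * The remainder and the end points *)

(** The coefficients of ptilde_(n,k), which are (1 - x) (1 - n x), 2 n phi and
    x (1 - n (1 - x)), are bounded by n / phi times the coefficients (1 - x)^2,
    2 phi and x^2 of p_(n,k). *)
Lemma normr_modp2_le (R : realType) m (k : nat) (x : R) : 0 < x < 1 ->
  `|modp2 m.+2 k x| <= m.+2%:R / (x * (1 - x)) * classical_weight m k x.
Proof.
move=> /andP[x0 x1]; have x01 : x \in `[0, 1] by rewrite in_itv/= !ltW.
have z0 : 0 < 1 - x by rewrite subr_gt0.
rewrite modp2E /classical_weight /blend.
have N1 : 1 <= m.+2%:R :> R by rewrite ler1n.
have := bernstein_ge0 m k x01; have := bernstein_ge0 m (k%:Z - 1) x01.
have := bernstein_ge0 m (k%:Z - 2) x01.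
move: (m.+2%:R : R) N1 => N N1.
move: (bernstein _ _ _) (bernstein _ _ _) (bernstein _ _ _) => B0 B1 B2 h2 h1 h0.
have step (a c b : R) : 0 <= b -> `|a| <= c -> `|a * b| <= c * b.
  by move=> b0 ac; rewrite normrM [`|b|]ger0_norm// ler_wpM2r.
have pos : 0 < x * (1 - x) by rewrite mulr_gt0.
rewrite [leRHS](_ : _ = N * (1 - x) ^+ 2 / (x * (1 - x)) * B0
  + N * (2 * (x * (1 - x))) / (x * (1 - x)) * B1
  + N * x ^+ 2 / (x * (1 - x)) * B2); last by ring.
apply: le_trans (ler_normD _ _) _; apply: lerD; last first.
  apply: step => //; rewrite ler_pdivlMr//.
  rewrite (_ : N * x ^+ 2 - (N - 1) * x = x * (1 - N * (1 - x)));
    last by ring.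
  rewrite normrM [`|x|]gtr0_norm//.
  have nb : `|1 - N * (1 - x)| <= N by rewrite ler_norml; apply/andP; split; nra.
  rewrite (_ : N * x ^+ 2 = x * x * (1 * N)); last by ring.
  rewrite [leLHS](_ : _ = x * x * ((1 - x) * `|1 - N * (1 - x)|));
    last by ring.
  apply: ler_wpM2l; first by rewrite mulr_ge0// ltW.
  by apply: ler_pM => //; [exact: ltW|lra].
apply: le_trans (ler_normD _ _) _; apply: lerD.
  apply: step => //; rewrite ler_pdivlMr//.
  rewrite (_ : N * x ^+ 2 - (N + 1) * x + 1 = (1 - x) * (1 - N * x));
    last by ring.
  rewrite normrM [`|1 - x|]gtr0_norm//.
  have nb : `|1 - N * x| <= N by rewrite ler_norml; apply/andP; split; nra.
  rewrite (_ : N * (1 - x) ^+ 2 = (1 - x) * (1 - x) * (1 * N)); last by ring.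
  rewrite [leLHS](_ : _ = (1 - x) * (1 - x) * (x * `|1 - N * x|));
    last by ring.
  apply: ler_wpM2l; first by rewrite mulr_ge0// ltW.
  by apply: ler_pM => //; exact: ltW.
apply: step => //; rewrite mulrA mulfK ?gt_eqF//.
rewrite ger0_norm; last by rewrite !mulr_ge0//; lra.
by rewrite mulrAC -mulrA [2 * N]mulrC ler_piMr//; nra.
Qed.

Lemma modU2_horner (R : realType) m (p : {poly R}) x :
  modU2 m.+2 (horner p) x =
  \sum_(j < size p) p`_j * modU2 m.+2 (fun t => t ^+ j) x.
Proof.
have -> : horner p = (fun t => \sum_(j < size p) p`_j * t ^+ j).
  by apply/funext => t; rewrite horner_coef.
rewrite modU2_nodal.
under eq_bigr => k _.
  rewrite (@nodal_sum _ _ _ (size p) (fun j => p`_j)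
    (fun j t => t ^+ j)); last first.
    by move=> j; apply: continuous_subspaceT; exact: exprn_continuous.
  rewrite mulr_sumr; over.
rewrite exchange_big /=; apply: eq_bigr => j _.
rewrite modU2_nodal mulr_sumr; apply: eq_bigr => k _; exact: mulrCA.
Qed.

Lemma expands_modU2_horner (R : realType) (p : {poly R}) x :
  expands (fun m => modU2 m.+2 (horner p) x) p.[x] 0.
Proof.
have term j : (j < size p)%N ->
  expands (fun m => p`_j * modU2 m.+2 (fun t => t ^+ j) x) (p`_j * x ^+ j) 0.
  move=> _; have := expandsM (expands_cst p`_j) (expands_modU2_monomial j x).
  by apply: eq_expands => [m||] //; ring.
apply: eq_expands (expands_sum term) => [m||].
- by rewrite modU2_horner.
- by rewrite horner_coef.
- by rewrite big1.
Qed.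

(** n / phi from the weights and O(n^-3) from the sixth central moment. *)
Lemma expands_modU2_remainder (R : realType) (g : R -> R) (x M : R) :
  0 < x < 1 ->
  {within `[0, 1], continuous g} ->
  (forall t, t \in `[0, 1] -> `|g t| <= M * `|t - x| ^+ 6) ->
  expands (fun m => modU2 m.+2 g x) 0 0.
Proof.
move=> x01 gC gM; have /andP[x0 x1] := x01.
have pos : 0 < x * (1 - x) by rewrite mulr_gt0// subr_gt0.
have PC : {within `[0, 1], continuous (fun t => (t - x) ^+ 6)}.
  apply: continuous_subspaceT => t.
  apply: (@continuous_comp _ _ _ (fun t => t - x) (fun t => t ^+ 6)).
    by apply: cvgB; [exact: cvg_id|exact: cvg_cst].
  exact: exprn_continuous.
have M0 : 0 <= M.
  have := le_trans (normr_ge0 _) (gM 0 _); rewrite in_itv/= lexx ler01 => /(_ isT).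
  by rewrite pmulr_lge0// exprn_gt0// sub0r normrN normr_gt0 gt_eqF.
exists (M / (x * (1 - x)) * 10000) => m.
rewrite mul0r addr0 subr0 modU2_nodal; apply: le_trans (ler_norm_sum _ _ _) _.
have N0 : 0 < m.+2%:R :> R by rewrite ltr0n.
apply: (@le_trans _ _ (m.+2%:R / (x * (1 - x)) * M * \sum_(k < m.+3)
    classical_weight m k x * nodal m.+2 k (fun t => (t - x) ^+ 6))).
  rewrite mulr_sumr; apply: ler_sum => k _.
  rewrite normrM mulrACA; apply: ler_pM => //; first exact: normr_modp2_le.
  rewrite -nodalZ//; apply: ler_norm_nodal => //; first exact: within_continuousZ.
  move=> t t01; have := gM t t01; rewrite -normrX.
  by rewrite [X in _ <= _ * X -> _]ger0_norm// exprn_even_ge0.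
have [x00 x11] := (ltW x0, ltW x1).
have := @sixth_central_moment_le R m x; rewrite in_itv/= x00 x11 => /(_ isT) H.
apply: (@le_trans _ _ (m.+2%:R / (x * (1 - x)) * M * (10000 / m.+2%:R ^+ 3))).
  by rewrite ler_wpM2l// !mulr_ge0// ?invr_ge0 ltW.
rewrite le_eqVlt; apply/orP; left; apply/eqP.
have := gt_eqF N0; have := gt_eqF pos.
move: (m.+2%:R : R) (x * (1 - x)) => N y /negbT y0 /negbT N0'.
by field; rewrite y0 N0'.
Qed.

Lemma modU2_endpoint0 (R : realType) m (f : R -> R) : modU2 m.+2 f 0 = f 0.
Proof.
rewrite modU2_nodal big_ord_recl /= big1 => [|k _].
  by rewrite modp2E /blend /= /nodal /= bin0 expr0 subr0 expr1n; ring.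
rewrite /bump add1n modp2E /blend.
suff -> : bernstein m k.+1 0 = 0 :> R by ring.
by rewrite /= expr0n mulr0 mul0r.
Qed.

Lemma modU2_endpoint1 (R : realType) m (f : R -> R) : modU2 m.+2 f 1 = f 1.
Proof.
rewrite modU2_nodal big_ord_recr /= big1 => [|[k km] _].
  rewrite modp2E /blend (_ : m.+2%:Z - 2 = m); last by lia.
  by rewrite /nodal /= eqxx binn subnn expr0 !expr1n subrr; ring.
rewrite modp2E /blend subrr.
suff -> : bernstein m (k%:Z - 2) 1 = 0 :> R by ring.
rewrite /bernstein; case E : (k%:Z - 2) => [i|//].
by rewrite subrr expr0n (_ : _ == _ = false) ?mulr0//; move: km E => /=; lia.
Qed.

(** * The order of approximation *)

Theorem theorem3p1 (R : realType) (f : R -> R) (x : R)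
    (hf : Ck_on `[0, 1] 6 f) (hx : x \in `[0, 1]) :
  (fun n : nat => modU2 n f x - f x) =O_\oo (fun n : nat => n%:R ^- 2 : R).
Proof.
suff [C H] : expands (fun m => modU2 m.+2 f x) (f x) 0.
  apply/eqO_exP; exists (`|C| + 1); first by rewrite ltr_wpDl.
  exists 2%N => // -[|[|m]] //= _.
  have := H m; rewrite mul0r addr0 => /le_trans; apply.
  rewrite [`|_ ^- 2|]ger0_norm ?invr_ge0 ?exprn_ge0//.
  rewrite ler_wpM2r ?invr_ge0 ?exprn_ge0//.
  by apply: le_trans (ler_norm _) _; rewrite lerDl.
have [->|x0] := eqVneq x 0.
  by apply: eq_expands (expands_cst (f 0)) => // m; rewrite modU2_endpoint0.
have [->|x1] := eqVneq x 1.
  by apply: eq_expands (expands_cst (f 1)) => // m; rewrite modU2_endpoint1.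
have x01 : 0 < x < 1.
  move: hx; rewrite in_itv/= => /andP[x_ge0 x_le1].
  by rewrite lt_def x0 x_ge0 lt_neqAle x1 x_le1.
have [p [M fM]] := Ck_on_taylor hx hf.
have fC : {within `[0, 1], continuous f}.
  by case: hf => g [fg _]; exact: is_derive_within_continuous fg.
have pC : {within `[0, 1], continuous (horner p)}.
  by apply: continuous_subspaceT; exact: continuous_horner.
pose g t := f t + (-1) * p.[t].
have gC : {within `[0, 1], continuous g}.
  by apply: within_continuousD => //; exact: within_continuousZ.
have gM t : t \in `[0, 1] -> `|g t| <= M * `|t - x| ^+ 6.
  by rewrite /g mulN1r; exact: fM.
have gx : g x = 0.
  by have := gM x hx; rewrite subrr normr0 expr0n mulr0 normr_le0 => /eqP.
have := expandsD (expands_modU2_horner p x) (expands_modU2_remainder x01 gC gM).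
apply: eq_expands => [m||]; [|by move: gx; rewrite /g; lra|by rewrite addr0].
rewrite !modU2_nodal -big_split/=; apply: eq_bigr => k _.
rewrite -mulrDr -nodalD//; congr (_ * nodal _ _ _).
by apply/funext => t; rewrite /g mulN1r addrC subrK.
Qed.
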